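(* Let $V\subseteq\mathbb{C}^n$ be an irreducible projective variety (regarded as its affine cone in $\mathbb{C}^n$) with vanishing ideal $I=I(V)\subseteq\mathbb{C}[x_1,\ldots,x_n]$, and let $G_I$ be the symmetry Lie group of $I$. If $\dim(G_I)<\dim(V)$, then $V$ is not a toric variety.
   Context: Let $R=\mathbb{C}[x_1,\ldots,x_n]$. An irreducible projective variety $V$ is treated as an irreducible affine variety $V\subseteq\mathbb{C}^n$ whose vanishing ideal $I(V)\subseteq R$ is a homogeneous prime ideal; $\dim(V)$ is the dimension of this affine variety in $\mathbb{C}^n$. The group $\mathrm{GL}_n(\mathbb{C})$ acts on $R$ by $(g\cdot p)(x)=p(g^{-1}x)$, where $x=(x_1,\ldots,x_n)^T$. For a homogeneous prime ideal $I\subseteq R$, the symmetry Lie group of $I$ is the stabilizer $G_I=\{g\in\mathrm{GL}_n(\mathbb{C})\mid g\cdot p\in I \text{ for all } p\in I\}$. It is a closed subgroup of $\mathrm{GL}_n(\mathbb{C})$ and a complex Lie group; $\dim(G_I)$ is its dimension as a complex manifold. Toric variety: let $\mathcal{A}=\{\mathbf{a}_1,\ldots,\mathbf{a}_n\}\subseteq\mathbb{Z}^r$ be a finite subset, where $\mathbf{a}_i=(a_{1i},\ldots,a_{ri})$, and let $\chi^{\mathbf{a}_i}(\mathbf{t})=t_1^{a_{1i}}\cdots t_r^{a_{ri}}$ be the corresponding characters of the torus $\mathbb{T}_r=(\mathbb{C}\setminus\{0\})^r$. Define $\Phi_{\mathcal{A}}:\mathbb{T}_r\to(\mathbb{C}\setminus\{0\})^n$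 by $\Phi_{\mathcal{A}}(\mathbf{t})=(\chi^{\mathbf{a}_1}(\mathbf{t}),\ldots,\chi^{\mathbf{a}_n}(\mathbf{t}))$. An affine variety $V\subseteq\mathbb{C}^n$ is a toric variety if it is the Zariski closure in $\mathbb{C}^n$ of the image of $\Phi_{\mathcal{A}}$ for some $r$ and some such $\mathcal{A}$. *)

(* Defs.v *)
From HB Require Import structures.
From mathcomp Require Import all_boot all_order all_algebra.
From mathcomp Require Import ring_quotient.
From mathcomp Require Import complex.
From mathcomp Require Import all_classical all_reals all_analysis.
(* The notations of [mpoly] are incompatible with those of MathComp-Analysis:
   [{mpoly K[n]}] is written [mpoly n K] below. *)
From mathcomp Require Import -(notations) mpoly.

Set Implicit Arguments.
Unset Strict Implicit.
Unset Printing Implicit Defensive.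

Import Order.TTheory GRing.Theory Num.Theory.
Import numFieldNormedType.Exports.

Local Open Scope classical_set_scope.
Local Open Scope ring_scope.

(* Everything is stated over a numFieldType K and used with K = R[i] for
   R : realType; affine space K^n is 'I_n -> K. *)

Section AffineVarieties.
Variables (K : numFieldType) (n : nat).
Implicit Types (V Z A : set ('I_n -> K)) (S I : set (mpoly n K)).

Definition zero_locus S : set ('I_n -> K) :=
  [set x | forall p, S p -> meval x p = 0].

Definition vanishing_ideal V : set (mpoly n K) :=
  [set p | forall x, V x -> meval x p = 0].

Definition zariski_closed V : Prop := exists S, V = zero_locus S.

Definition zariski_closure A : set ('I_n -> K) := smallest zariski_closed A.

Definition zariski_irreducible V : Prop :=
  V !=set0 /\
  forall Y Z, zariski_closed Y -> zariski_closed Z ->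
    V `<=` Y `|` Z -> V `<=` Y \/ V `<=` Z.

Definition affine_variety V : Prop := zariski_closed V /\ zariski_irreducible V.

Definition variety_chain V (d : nat) : Prop :=
  exists Z : nat -> set ('I_n -> K),
    (forall i, (i <= d)%N -> affine_variety (Z i) /\ Z i `<=` V) /\
    (forall i, (i < d)%N -> Z i `<` Z i.+1).

(* dim V = d, as the supremum of the lengths of the strict chains
   Z_0 < ... < Z_d of irreducible closed subsets of V. *)
Definition variety_dim V (d : nat) : Prop :=
  variety_chain V d /\ forall k, variety_chain V k -> (k <= d)%N.

Definition prime_ideal I : Prop :=
  idealr_closed (mem I) /\ prime_idealr_closed (mem I).

Definition homogeneous_ideal I : Prop :=
  forall p, I p -> forall d, I (pihomog mdeg d p).

(* The affine cone in K^n of an irreducible projective variety. *)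
Definition projective_variety V : Prop :=
  [/\ affine_variety V, prime_ideal (vanishing_ideal V) &
      homogeneous_ideal (vanishing_ideal V)].

(* (g . p)(x) = p(g^-1 x), x being a column vector. *)
Definition gl_act (g : 'M[K]_n) (p : mpoly n K) : mpoly n K :=
  comp_mpoly
    [tuple \sum_(j < n) invmx g i j *: mpolyX K (mnm1 j) | i < n] p.

Definition symmetry_group I : set 'M[K]_n :=
  [set g | g \in unitmx /\ forall p, I p -> I (gl_act g p)].

End AffineVarieties.

Section ComplexManifolds.
Variables (K : numFieldType) (n : nat).

(* Complex differentiability on an open set, when K = R[i]. *)
Definition holomorphic_on (U : set 'M[K]_n) (f : 'M[K]_n -> 'M[K]_n) : Prop :=
  forall x, U x -> differentiable f x.

(* G is a d-dimensional embedded complex submanifold of the space of matrices: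
   near each of its points, a biholomorphic map phi (with inverse psi) between
   open sets straightens G to a d-dimensional linear subspace W.  This is the
   dimension of a closed complex Lie subgroup G of GL_n(C), which is open in
   the space of matrices. *)
Definition complex_manifold_dim (G : set 'M[K]_n) (d : nat) : Prop :=
  forall g, G g ->
  exists (U : set 'M[K]_n) (phi psi : 'M[K]_n -> 'M[K]_n)
         (W : {vspace 'M[K]_n}),
    [/\ open U /\ U g,
        open (phi @` U) /\ (forall x, U x -> psi (phi x) = x),
        holomorphic_on U phi /\ holomorphic_on (phi @` U) psi,
        \dim W = d &
        forall x, U x -> (G x <-> phi x \in W)].

End ComplexManifolds.

Section ToricVarieties.
Variables (K : numFieldType) (r n : nat).

Definition torus : set ('I_r -> K) := [set t | forall j, t j != 0].

(* The columns of a are the exponent vectors a_1, ..., a_n of Z^r. *)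
Definition monomial_map (a : 'M[int]_(r, n)) (t : 'I_r -> K) : 'I_n -> K :=
  fun i => \prod_(j < r) t j ^ a j i.

End ToricVarieties.

Definition toric_variety (K : numFieldType) (n : nat)
    (V : set ('I_n -> K)) : Prop :=
  exists (r : nat) (a : 'M[int]_(r, n)),
    V = zariski_closure (monomial_map a @` @torus K r).

(* Main.v *)
Require Import Defs.
From mathcomp Require Import all_boot all_order all_algebra complex.
From mathcomp Require Import all_classical all_reals all_analysis.
From mathcomp Require Import -(notations) mpoly.
From mathcomp Require Import zify.
Import Order.TTheory GRing.Theory Num.Theory.
Import numFieldNormedType.Exports.
Local Open Scope classical_set_scope.
Local Open Scope ring_scope.

(** Suppose that [V] is the closure of the image of the monomial map with
    exponent matrix [a], and let [s] be the rank of [a].  The theorem follows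
    from [dim V <= s <= dim G].

    For [dim V <= s] ([chain_length_le_rank]), growth rates are compared.  A
    strict chain of [d + 1] irreducible closed subsets of [V] provides
    polynomials [f_1, ..., f_d], the [i]-th of which vanishes on the [i]-th
    member of the chain but not on the next one; their monomials with all
    exponents below [N] are linearly independent as functions on [V]
    ([chain_growth]).  This gives [N ^ d] independent functions of degree
    [O(N)].  On the torus, however, a monomial of [K^n] becomes a Laurent
    monomial whose exponent vector is determined by [s] of its entries, so that
    polynomials of degree [O(N)] restrict to a space of dimension [O(N ^ s)]
    ([torus_linindep_card]).  Letting [N] grow, [d <= s].

    For [s <= dim G] ([rank_le_symmetry_dim]), the torus acts on [V] by diagonal
    matrices, which therefore belong to [G].  Moving the [j]-th coordinate of
    the torus along [1 + z] gives a curve in [G] through the identity, whose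
    velocity at [z = 0] is the diagonal matrix formed with the [j]-th row of
    [a].  Taking [s] independent rows yields [s] independent tangent vectors,
    and a chart that straightens [G] sends them to independent vectors of a
    subspace of dimension [dim G] ([free_tangents_le_dim]).

    All of this takes place over an arbitrary numerical field. *)

(** * Linearly independent families of functions *)

Definition linindep_on {K : fieldType} {X : Type} {T : finType} (A : set X)
    (g : T -> X -> K) : Prop :=
  forall c : T -> K,
    (forall x, A x -> \sum_t c t * g t x = 0) -> forall t, c t = 0.

(** The coordinates of the [g t] on the spanning family [h] form a matrix with
    independent rows, even when [h] itself is not independent. *)
Lemma linindep_card {K : fieldType} {X : Type} {T S : finType} {A : set X}
    {g : T -> X -> K} (h : S -> X -> K) (M : T -> S -> K) :
  (forall t x, A x -> g t x = \sum_s M t s * h s x) ->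
  linindep_on A g -> (#|T| <= #|S|)%N.
Proof.
move=> gE gfree.
pose N := \matrix_(i < #|T|, j < #|S|) M (enum_val i) (enum_val j).
suff /eqP <- : row_free N by exact: rank_leq_col.
apply: inj_row_free => v vN0.
have v0 : forall t, v ord0 (enum_rank t) = 0.
  apply: gfree => x Ax.
  under eq_bigr => t _ do rewrite gE // mulr_sumr.
  rewrite exchange_big big1 //= => s _.
  under eq_bigr => t _ do rewrite mulrA.
  rewrite -mulr_suml.
  have /matrixP/(_ ord0 (enum_rank s)) := vN0.
  rewrite !mxE => vs.
  rewrite [X in X * _](_ : _ = 0) ?mul0r // -[RHS]vs.
  rewrite [RHS](reindex _ (onW_bij _ (enum_rank_bij T))).
  by apply: eq_bigr => t _; rewrite mxE !enum_rankK.
by apply/rowP => i; rewrite -(enum_valK i) v0 mxE.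
Qed.

(** * Independent polynomials along a chain of irreducible sets *)

Section Zariski.
Context {K : numFieldType} {n : nat}.
Implicit Types (V Z A : set ('I_n -> K)) (p q f : mpoly n K).

Lemma vanishing_prime {Z p q} : zariski_irreducible Z ->
  vanishing_ideal Z (p * q) -> vanishing_ideal Z p \/ vanishing_ideal Z q.
Proof.
move=> [_ Zirr] pq0.
have [||x Zx|sub|sub] := Zirr (zero_locus [set p]) (zero_locus [set q]).
- by exists [set p].
- by exists [set q].
- have /eqP := pq0 _ Zx; rewrite mevalM mulf_eq0.
  by case/orP => /eqP ?; [left|right] => _ ->.
- by left => x /sub; apply.
- by right => x /sub; apply.
Qed.

Lemma vanishing_zariski_closure {A p} :
  vanishing_ideal A p -> vanishing_ideal (zariski_closure A) p.
Proof.
move=> pA x /(_ (zero_locus [set p])); apply => //; split.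
  by exists [set p].
by move=> y Ay _ ->; exact: pA.
Qed.

Lemma vanishing_separates {Z Z'} : zariski_closed Z -> Z `<` Z' ->
  exists2 f, vanishing_ideal Z f & ~ vanishing_ideal Z' f.
Proof.
move=> [S ->] [_ nsub]; apply: contrapT => nf; apply: nsub => x Z'x p Sp.
apply: contrapT => px; apply: nf; exists p; first by move=> y; apply.
by move=> pZ'; apply: px; exact: pZ'.
Qed.

(** In a relation [\sum_j P_j f ^ j = 0] on [Z'], where the [P_j] are
    combinations of the [g t], suppose that [P_k] is the first nonzero
    coefficient: [f ^ k] may be cancelled because [Z'] is irreducible, and
    restricting to [Z], where [f] vanishes, leaves [P_k = 0] there. *)
Lemma linindep_powers {T : finType} (N : nat) {g : T -> mpoly n K} {Z Z' f} :
  Z `<=` Z' -> zariski_irreducible Z' ->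
  vanishing_ideal Z f -> ~ vanishing_ideal Z' f ->
  linindep_on Z (fun t x => meval x (g t)) ->
  linindep_on Z' (fun (tj : T * 'I_N) x => meval x (g tj.1 * f ^+ tj.2)).
Proof.
move=> sZZ' Z'irr fZ fZ' gfree c c0.
pose P (j : 'I_N) := \sum_t c (t, j) *: g t.
have PE x : Z' x -> \sum_j meval x (P j) * meval x f ^+ j = 0.
  move=> Z'x; rewrite -[RHS](c0 x Z'x).
  transitivity (\sum_t \sum_j c (t, j) * meval x (g t * f ^+ j)); last first.
    by rewrite pair_big; apply: eq_bigr => -[].
  rewrite exchange_big; apply: eq_bigr => j _; rewrite /P raddf_sum mulr_suml.
  by apply: eq_bigr => t _ /=; rewrite mevalZ mevalM rmorphXn /= mulrA.
suff c_small k : forall t (j : 'I_N), (j < k)%N -> c (t, j) = 0.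
  by case=> t j; exact: (c_small N).
elim: k => // k IHk t j.
rewrite ltnS leq_eqVlt => /predU1P[jk|]; last exact: IHk.
pose q := \sum_(i : 'I_N | (k <= i)%N) P i * f ^+ (i - k).
have qE x : meval x q =
    \sum_(i : 'I_N | (k <= i)%N) meval x (P i) * meval x f ^+ (i - k).
  by rewrite raddf_sum; apply: eq_bigr => i _; rewrite /= mevalM rmorphXn.
have fkq : vanishing_ideal Z' (f ^+ k * q).
  move=> x Z'x; rewrite mevalM qE rmorphXn /= mulr_sumr -[RHS](PE x Z'x).
  rewrite [RHS](bigID (fun i : 'I_N => (k <= i)%N)) /= [X in _ + X]big1 ?addr0.
    by apply: eq_bigr => i ki; rewrite mulrCA -exprD subnKC.
  move=> i; rewrite -ltnNge => ik.
  rewrite [P i]big1 ?meval0 ?mul0r // => u _.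
  by rewrite IHk // scale0r.
have qZ' : vanishing_ideal Z' q.
  have [fk0|//] := vanishing_prime Z'irr fkq; case: fZ' => x /fk0.
  by rewrite rmorphXn /= => /eqP; rewrite expf_eq0 => /andP[_ /eqP].
apply: (gfree (fun u => c (u, j))) => x Zx.
have := qZ' x (sZZ' x Zx).
rewrite qE (bigD1 j) /= -jk ?leqnn // subnn expr0 mulr1.
rewrite [X in _ + X]big1 ?addr0 => [|i /andP[ki ij]]; last first.
  have ik : (0 < i - j)%N by rewrite subn_gt0 ltn_neqAle ki andbT eq_sym ij.
  by rewrite (fZ x Zx) expr0n eqn0Ngt ik mulr0.
move=> Pj0; rewrite -[RHS]Pj0 /P raddf_sum; apply: eq_bigr => u _ /=.
by rewrite mevalZ.
Qed.

Lemma msizeM_leq p q :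
  (mmeasure mdeg (p * q) <= mmeasure mdeg p + mmeasure mdeg q)%N.
Proof.
have [->|p0] := eqVneq p 0; first by rewrite mul0r mmeasure0.
have [->|q0] := eqVneq q 0; first by rewrite mulr0 mmeasure0.
by rewrite msizeM // leq_pred.
Qed.

Lemma msizeX_leq p j : (mmeasure mdeg (p ^+ j) <= j * mmeasure mdeg p + 1)%N.
Proof.
elim: j => [|j IHj]; first by rewrite expr0 msize1.
rewrite exprS mulSn -addnA.
by apply: leq_trans (msizeM_leq _ _) _; rewrite leq_add2l.
Qed.

(** A lower bound for the growth of the coordinate ring of [Z d]: the
    polynomials are the monomials with exponents less than [N] in [d]
    polynomials chosen along the chain, independently of [N]; hence the
    constant [C] does not depend on [N] either. *)
Lemma chain_growth (Z : nat -> set ('I_n -> K)) d :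
  (forall i, (i <= d)%N -> affine_variety (Z i)) ->
  (forall i, (i < d)%N -> Z i `<` Z i.+1) ->
  exists C, forall N, (0 < N)%N -> exists (T : finType) (g : T -> mpoly n K),
    [/\ #|T| = (N ^ d)%N, forall t, (mmeasure mdeg (g t) <= C * N)%N &
        linindep_on (Z d) (fun t x => meval x (g t))].
Proof.
elim: d => [|d IHd] Zaff Zlt.
  exists 1%N => N N0; exists unit, (fun=> 1).
  split=> [|_|c c0 []]; rewrite ?card_unit ?msize1 ?mul1n //.
  have [_ [[x Zx] _]] := Zaff 0%N isT.
  rewrite -[RHS](c0 x Zx) (bigD1 tt) //= big1 ?addr0; last by case.
  by rewrite meval1 mulr1.
have [C gC] := IHd (fun i id => Zaff i (leqW id)) (fun i id => Zlt i (ltnW id)).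
have [f fZ fZ'] := vanishing_separates (Zaff d (leqnSn d)).1 (Zlt d (ltnSn d)).
exists (C + mmeasure mdeg f + 1)%N => N N0.
have [T [g [cT gN gfree]]] := gC N N0.
exists (T * 'I_N)%type, (fun tj : T * 'I_N => g tj.1 * f ^+ tj.2); split.
- by rewrite card_prod cT card_ord expnSr.
- case=> t j /=; apply: leq_trans (msizeM_leq _ _) _.
  rewrite -addnA mulnDl; apply: leq_add; first exact: gN.
  apply: leq_trans (msizeX_leq _ _) _.
  rewrite mulnDl mul1n; apply: leq_add => //.
  by rewrite mulnC leq_mul2l (ltnW (ltn_ord j)) orbT.
- have [sub _] := Zlt d (ltnSn d).
  exact: linindep_powers sub (Zaff _ (leqnn _)).2 fZ fZ' gfree.
Qed.

End Zariski.

(** * Polynomials restricted to the image of a torus *)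

Section Torus.
Context {K : numFieldType} {r n : nat} (a : 'M[int]_(r, n)).
Implicit Types (m : multinom n) (u : 'I_r -> K).

Local Notation A := (map_mx intr a : 'M[K]_(r, n)).

(** The exponent of the [j]-th torus coordinate in the pullback of ['X_[m]]. *)
Definition weight (j : 'I_r) m : int := \sum_i a j i * (m i)%:Z.

Definition weight_bound : nat := (\sum_j \sum_i `|a j i|)%N.

Lemma meval_monomial_map u m : torus u ->
  meval (monomial_map a u) (mpolyX K m) = \prod_j u j ^ weight j m.
Proof.
move=> u0; rewrite mevalX /monomial_map /=.
under eq_bigr => i _ do rewrite -prodrXl.
rewrite exchange_big; apply: eq_bigr => j _ /=.
rewrite (big_morph (fun k : int => u j ^ k) (id1 := 1) (op1 := *%R)) //.
  by apply: eq_bigr => i _; rewrite -exprz_exp.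
by move=> k l; rewrite expfzDr //; exact: u0.
Qed.

Lemma weight_le j m : `|weight j m| <= (weight_bound * mdeg m)%:Z.
Proof.
rewrite mdegE big_distrr /=.
apply: le_trans (ler_norm_sum _ _ _) _.
rewrite (big_morph Posz PoszD (erefl _)); apply: ler_sum => i _.
rewrite normrM PoszM [X in _ * X]ger0_norm // ler_wpM2r // -abszE lez_nat.
by rewrite /weight_bound (bigD1 j) //= (bigD1 i) //= -addnA leq_addr.
Qed.

(** The weights are the entries of the product of [a] by the column [m], and
    every row of [a] is a combination of the rows selected by
    [maxrankfun]. *)
Lemma weight_determined {m m'} :
  (forall k, weight (maxrankfun A k) m = weight (maxrankfun A k) m') ->
  forall j, weight j m = weight j m'.
Proof.
set e := maxrankfun A => eqw.
pose v (l : multinom n) : 'cV[K]_n := \col_i (l i)%:R.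
have Av (l : multinom n) j : (A *m v l) j 0 = (weight j l)%:~R.
  rewrite mxE rmorph_sum; apply: eq_bigr => i _.
  by rewrite !mxE rmorphM /= -pmulrn.
have /submxP[D AE] : (A <= rowsub e A)%MS by rewrite eq_maxrowsub.
have vE : A *m v m = A *m v m'.
  rewrite AE -!mulmxA; congr (_ *m _).
  by apply/colP => k; rewrite !mul_rowsub_mx [LHS]mxE [RHS]mxE !Av eqw.
by move=> j; apply: (@intr_inj K); rewrite -!Av vE.
Qed.

(** In degree at most [D] the weights lie between [- weight_bound * D] and
    [weight_bound * D]; the shift makes them natural numbers, which leaves
    [2 * (weight_bound * D) + 1] possible values for each of them. *)
Definition weight_key D m :
    {ffun 'I_(\rank A) -> 'I_(2 * (weight_bound * D)).+1} :=
  [ffun k => inord `|weight (maxrankfun A k) m + (weight_bound * D)%:Z|].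

Lemma weight_key_eq {D m m'} : (mdeg m <= D)%N -> (mdeg m' <= D)%N ->
  weight_key D m = weight_key D m' -> forall j, weight j m = weight j m'.
Proof.
move=> mD m'D /ffunP eqk; apply: weight_determined => k.
have := congr1 val (eqk k); rewrite !ffunE /=.
have bnd l j : (mdeg l <= D)%N -> `|weight j l| <= (weight_bound * D)%:Z.
  move=> lD; apply: le_trans (weight_le _ _) _.
  by rewrite lez_nat leq_mul2l lD orbT.
have := bnd _ (maxrankfun A k) mD.
have := bnd _ (maxrankfun A k) m'D.
move: (weight _ m) (weight _ m') (weight_bound * D)%N => w w' b.
by move=> wb w'b; rewrite !inordK; lia.
Qed.

(** An upper bound for the growth of the coordinate ring of a toric variety:
    on the torus, monomials with the same key are the same function, and the
    exponent [\rank A] counts the entries of a key. *)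
Lemma torus_linindep_card {T : finType} {g : T -> mpoly n K} {D} :
  (forall t, (mmeasure mdeg (g t) <= D)%N) ->
  linindep_on (monomial_map a @` @torus K r) (fun t x => meval x (g t)) ->
  (#|T| <= (2 * (weight_bound * D)).+1 ^ \rank A)%N.
Proof.
move=> gD gfree.
rewrite -[X in (_ <= X ^ _)%N]card_ord -[X in (_ <= _ ^ X)%N]card_ord.
rewrite -card_ffun.
pose key (m : bmultinom n D) := weight_key D m.
(* For each key a representative is chosen; a key that is not attained gets the
   zero function, and its coefficient is an empty sum. *)
pose h k (x : 'I_n -> K) :=
  if [pick m | key m == k] is Some m then meval x (mpolyX K m) else 0.
pose M t k := \sum_(m : bmultinom n D | key m == k) mcoeff m (g t).
apply: (linindep_card h M _ gfree) => t _ [u u0 <-].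
rewrite {1}(mpolywE (gD t)) raddf_sum (partition_big key xpredT) //=.
apply: eq_bigr => k _; rewrite mulr_suml; apply: eq_bigr => m /eqP mk.
rewrite mevalZ /h; case: pickP => [m' /eqP m'k|/(_ m)]; last by rewrite mk eqxx.
rewrite !meval_monomial_map //; congr (_ * _).
apply: eq_bigr => j _; congr (_ ^ _).
by apply: (@weight_key_eq D); rewrite ?(ltnW (bmdeg _)) // -/(key _) mk -m'k.
Qed.

(** A chain of length [d] forces [N ^ d <= E ^ s * N ^ s] for a constant [E]
    and all positive [N], where [s] is the rank of [a]; if [d > s], this is
    false for [N = E ^ s + 1]. *)
Lemma chain_length_le_rank d :
  variety_chain (zariski_closure (monomial_map a @` @torus K r)) d ->
  (d <= \rank A)%N.
Proof.
move=> [Z [ZV Zlt]]; rewrite leqNgt; apply/negP => sd.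
have [C gC] := chain_growth Z d (fun i id => (ZV i id).1) Zlt.
set s := \rank A in sd *.
pose E := (2 * (weight_bound * C)).+1; pose N := (E ^ s).+1.
have [T [g [cT gN gfree]]] := gC N isT.
have gfree' : linindep_on (monomial_map a @` @torus K r)
    (fun t x => meval x (g t)).
  (* A relation on the image of the torus extends to its closure. *)
  move=> c c0; apply: gfree => x Zx.
  have ev y : meval y (\sum_t c t *: g t) = \sum_t c t * meval y (g t).
    by rewrite raddf_sum; apply: eq_bigr => t _ /=; rewrite mevalZ.
  have Vx := (ZV d (leqnn d)).2 x Zx.
  rewrite -ev; apply: (vanishing_zariski_closure _ x Vx).
  by move=> y Ay; rewrite ev c0.
have := torus_linindep_card gN gfree'; rewrite cT -/s.
apply/negP; rewrite -ltnNge.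
have le_exp b c k : (b <= c)%N -> (b ^ k <= c ^ k)%N.
  by move=> bc; case: k => // k; rewrite leq_exp2r.
apply: (@leq_ltn_trans ((E * N) ^ s)).
  by apply: le_exp; rewrite /E [X in (_ <= X)%N]mulSn -!mulnA -add1n leq_add2r.
apply: (@leq_trans (N ^ s.+1)); last by rewrite leq_pexp2l.
by rewrite expnMn expnS ltn_pmul2r ?expn_gt0 // /N ltnS.
Qed.

End Torus.

(** * Tangent vectors to an embedded complex manifold *)

Section Manifold.
Context {K : numFieldType} {n : nat}.

Lemma linear_mx_continuous {p q : nat} {V : normedModType K}
    (f : {linear 'M[K]_(p, q) -> V}) : continuous f.
Proof.
move=> M; apply: differentiable_continuous.
have -> : (f : _ -> _) =
    \sum_i \sum_j (fun N : 'M[K]_(p, q) => (N i j : K) *: f (delta_mx i j)).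
  apply/funext => N; rewrite {1}[N]matrix_sum_delta linear_sum fct_sumE.
  apply: eq_bigr => i _; rewrite linear_sum fct_sumE; apply: eq_bigr => j _.
  by rewrite linearZ.
apply: differentiable_sum => i; apply: differentiable_sum => j.
exact/differentiableZl/differentiable_coord.
Qed.

(** [W] is the kernel of a linear map, which is continuous and hence commutes
    with the derivative. *)
Lemma derive_in_subspace (W : {vspace 'M[K]_n}) (h : K -> 'M[K]_n) :
  differentiable h 0 -> (\forall z \near 0, h z \in W) -> 'D_1 h 0 \in W.
Proof.
move=> dh hW.
pose pi : 'End('M[K]_n) := (\1 - projv W)%VF.
have piE v : pi v = v - projv W v by rewrite /pi add_lfunE opp_lfunE id_lfunE.
have cpi : continuous (pi : _ -> _) by exact: linear_mx_continuous.
have dpi : differentiable (pi : _ -> _) (h 0) by exact: linear_differentiable.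
have : 'D_1 ((pi : _ -> _) \o h) 0 = 0.
  rewrite -[RHS](derive_cst (0 : 'M[K]_n) (0 : K) 1).
  apply: near_eq_derive; apply: filterS hW => z hz /=.
  by rewrite piE projv_id ?subrr.
rewrite deriveE; last exact: differentiable_comp.
rewrite diff_comp //= diff_lin // -deriveE //= piE => /eqP.
by rewrite subr_eq0 => /eqP ->; exact: memv_proj.
Qed.

Lemma diff_injective {U : set 'M[K]_n} {phi psi : 'M[K]_n -> 'M[K]_n} {g} :
  open U -> U g -> (forall x, U x -> psi (phi x) = x) ->
  differentiable phi g -> differentiable psi (phi g) ->
  injective ('d phi g).
Proof.
move=> oU Ug phiK dphi dpsi.
have dK v : 'd psi (phi g) ('d phi g v) = v.
  have -> : 'd psi (phi g) ('d phi g v) = 'd (psi \o phi) g v.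
    exact: (esym (congr1 (fun F => F v) (diff_comp dphi dpsi))).
  rewrite -deriveE; last exact: differentiable_comp.
  rewrite -[RHS](derive_id g v); apply: near_eq_derive.
  by apply: filterS (open_nbhs_nbhs (conj oU Ug)) => x /phiK.
exact: (can_inj dK).
Qed.

(** The differential at [g] of a chart straightening [G] maps the velocities of
    curves drawn on [G] into the [d]-dimensional model subspace, and it is
    injective. *)
Lemma free_tangents_le_dim {G : set 'M[K]_n} {d} g {s}
    (gamma : 'I_s -> K -> 'M[K]_n) :
  complex_manifold_dim G d -> G g ->
  (forall j, differentiable (gamma j) 0) ->
  (forall j, gamma j 0 = g) ->
  (forall j, \forall z \near 0, G (gamma j z)) ->
  free [tuple ('D_1 (gamma j) 0 : 'M[K]_n) | j < s] ->
  (s <= d)%N.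
Proof.
move=> Gd Gg dgamma gamma0 Ggamma; set X := (X in free X) => Xfree.
have [U [phi [psi [W [[oU Ug] [_ phiK] [hphi hpsi] <- GW]]]]] := Gd g Gg.
have dphi : differentiable phi g by exact: hphi.
have dpsi : differentiable psi (phi g) by apply: hpsi; exists g.
have phi_inj := diff_injective oU Ug phiK dphi dpsi.
pose L := linfun ('d phi g).
have L0 : lker L = 0%VS.
  by apply/eqP/lker0P => v w; rewrite !lfunE; exact: phi_inj.
have -> : s = \dim (L @: <<X>>).
  by rewrite limg_dim_eq ?L0 ?capv0 // (eqP Xfree) size_tuple.
apply: dimvS; rewrite limg_span; apply/span_subvP => w /mapP[v vX ->].
case/mapP: vX => j _ ->.
rewrite lfunE /=.
have -> : 'd phi g ('D_1 (gamma j) 0) = 'D_1 (phi \o gamma j) 0.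
  rewrite -(gamma0 j) in dphi *.
  rewrite (deriveE _ (differentiable_comp (dgamma j) dphi)).
  by rewrite (diff_comp (dgamma j) dphi) (deriveE _ (dgamma j)).
apply: derive_in_subspace; first by apply: differentiable_comp; rewrite ?gamma0.
have Ugamma : \forall z \near 0, U (gamma j z).
  apply: (differentiable_continuous (dgamma j)); rewrite gamma0.
  exact: open_nbhs_nbhs.
apply: filterS2 Ugamma (Ggamma j) => z Uz Gz /=.
by apply/GW.
Qed.

End Manifold.

(** * The torus inside the symmetry group *)

Lemma is_derive_exprz {K : numFieldType} (k : int) :
  is_derive (0 : K) 1 (fun z : K => (1 + z) ^ k) k%:~R.
Proof.
have d1 : is_derive (0 : K) 1 (fun z : K => 1 + z) 1.
  by apply: is_derive_eq; rewrite add0r.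
have dX m : is_derive (0 : K) 1 (fun z : K => (1 + z) ^+ m) m%:R.
  have := is_deriveX m d1; rewrite exprfctE addr0 expr1n mulr1.
  by rewrite [_ *: 1]mulr1.
have dV (F : K -> K) c : F 0 = 1 -> is_derive (0 : K) 1 F c ->
    is_derive (0 : K) 1 (fun z => (F z)^-1) (- c).
  move=> F0 [dF <-]; have F0neq : F 0 != 0 by rewrite F0 oner_neq0.
  apply: DeriveDef; first exact: derivableV.
  by rewrite deriveV // F0 expr1n invr1 scaleN1r.
case: k => m; first exact: dX.
rewrite NegzE rmorphN; apply: (dV (fun z => (1 + z) ^+ m.+1)) => //.
by rewrite addr0 expr1n.
Qed.

Definition diagonal {K : numFieldType} {n : nat} (x : 'I_n -> K) : 'M[K]_n :=
  diag_mx (\row_i x i).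

Lemma diagonal1 {K : numFieldType} {n : nat} {x : 'I_n -> K} :
  (forall i, x i = 1) -> diagonal x = 1%:M.
Proof.
move=> x1; rewrite /diagonal -diag_const_mx; congr diag_mx.
by apply/rowP => i; rewrite !mxE x1.
Qed.

Lemma meval_gl_act_diagonal {K : numFieldType} {n : nat} {x : 'I_n -> K} y p :
  (forall i, x i != 0) ->
  meval y (gl_act (diagonal x) p) = meval (fun i => (x i)^-1 * y i) p.
Proof.
move=> x0.
have dV : invmx (diagonal x) = diagonal (fun i => (x i)^-1).
  have xV : diagonal (fun i => (x i)^-1) *m diagonal x = 1%:M.
    rewrite mulmx_diag -diag_const_mx; congr diag_mx; apply/rowP => i.
    by rewrite !mxE mulVf.
  have [_ xu] := mulmx1_unit xV.
  by rewrite -[RHS](mulmxK xu) xV mul1mx.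
rewrite /gl_act comp_mpoly_meval; apply: meval_eq => i; rewrite tnth_mktuple dV.
rewrite raddf_sum (bigD1 i) //= big1 ?addr0 => [|j ji].
  by rewrite mevalZ mevalXU !mxE eqxx.
by rewrite mevalZ !mxE eq_sym (negPf ji) mul0r.
Qed.

Section SymmetryDimension.
Context {K : numFieldType} {r n : nat} (a : 'M[int]_(r, n)).

Local Notation A := (map_mx intr a : 'M[K]_(r, n)).
Local Notation G := (symmetry_group (vanishing_ideal
  (zariski_closure (monomial_map a @` @torus K r)))).

Lemma monomial_map_one_coord (j : 'I_r) (w : K) :
  monomial_map a (fun k => if k == j then w else 1) = fun i => w ^ a j i.
Proof.
apply/funext => i; rewrite /monomial_map (bigD1 j) //= eqxx.
by rewrite big1 ?mulr1 // => k /negPf ->; rewrite exp1rz.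
Qed.

(** The monomial map is a group morphism, so that the inverse of the matrix
    permutes the points of the image of the torus. *)
Lemma torus_in_symmetry_group (u : 'I_r -> K) :
  torus u -> G (diagonal (monomial_map a u)).
Proof.
move=> u0.
have mu0 i : monomial_map a u i != 0.
  by apply/prodf_neq0 => j _; rewrite expfz_neq0.
split.
  by rewrite unitmxE det_diag unitfE; apply/prodf_neq0 => i _; rewrite mxE.
move=> p pV; apply: vanishing_zariski_closure => _ [v v0 <-].
rewrite meval_gl_act_diagonal //; apply: pV => Y [_]; apply.
exists (fun j => (u j)^-1 * v j) => [j|].
  by rewrite mulf_neq0 ?invr_eq0.
apply/funext => i; rewrite /monomial_map -prodfV -big_split.
apply: eq_bigr => j _ /=.
by rewrite exprzMl ?unitfE ?invr_eq0 // exprz_inv -?invr_expz.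
Qed.

Lemma free_diag_rows :
  free [tuple diag_mx (row (maxrankfun A j) A) | j < \rank A].
Proof.
apply/freeP => k.
under eq_bigr => j _ do rewrite -tnth_nth tnth_mktuple -linearZ.
rewrite -linear_sum => k0 i.
suff kA : (\row_j k j) *m rowsub (maxrankfun A) A = 0.
  have := row_free_inj (maxrowsub_free A) (etrans kA (esym (mul0mx _ _))).
  by move=> /rowP/(_ i); rewrite !mxE.
rewrite mulmx_sum_row; under eq_bigr => j _ do rewrite row_rowsub mxE.
apply/rowP => l; have /matrixP/(_ l l) := k0.
by rewrite !mxE eqxx mulr1n => ->.
Qed.

(** The curves of the argument move one torus coordinate, indexed by one of the
    [\rank A] independent rows of [A], along [1 + z]. *)
Lemma rank_le_symmetry_dim d : complex_manifold_dim G d -> (\rank A <= d)%N.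
Proof.
move=> Gd; pose e := maxrankfun A.
pose t j (z : K) k : K := if k == e j then 1 + z else 1.
pose gamma j z := diagonal (monomial_map a (t j z)).
have gammaE j : gamma j =
    \sum_i (fun z : K => (1 + z) ^ a (e j) i *: (delta_mx i i : 'M[K]_n)).
  apply/funext => z; rewrite /gamma monomial_map_one_coord fct_sumE /diagonal.
  by rewrite diag_mx_sum_delta; apply: eq_bigr => i _; rewrite mxE.
have dpow k : differentiable (fun z : K => (1 + z) ^ k : K) 0.
  by have [/derivable1_diffP] := is_derive_exprz (K := K) k.
have dgamma j : differentiable (gamma j) 0.
  by rewrite gammaE; apply: differentiable_sum => i; exact: differentiableZl.
have Dgamma j : 'D_1 (gamma j) 0 = diag_mx (row (e j) A).
  rewrite gammaE derive_sum => [|i]; last exact/diff_derivable/differentiableZl.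
  rewrite diag_mx_sum_delta; apply: eq_bigr => i _.
  rewrite deriveE; last exact: differentiableZl.
  rewrite diffZl //= -deriveE // !mxE.
  by have [_ ->] := is_derive_exprz (K := K) (a (e j) i).
have gamma0 j : gamma j 0 = 1%:M.
  apply: diagonal1 => i.
  by rewrite /t monomial_map_one_coord addr0 exp1rz.
apply: (free_tangents_le_dim 1%:M gamma Gd) => // [|j|].
- rewrite -(@diagonal1 _ _ (monomial_map a (fun=> 1 : K))) => [|i].
    by apply: torus_in_symmetry_group => k; exact: oner_neq0.
  by rewrite /monomial_map big1 // => j _; rewrite exp1rz.
(* The first power of [1 + z] is continuous as one of the entries above. *)
- have nz : \forall z \near (0 : K), (1 + z) ^ (1 : int) != 0.
    apply: cvgr_neq0 (differentiable_continuous (dpow 1)) _.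
    by rewrite addr0 oner_neq0.
  apply: filterS nz => z z0.
  apply: torus_in_symmetry_group => k; rewrite /t.
  by case: ifP => // _; exact: oner_neq0.
- under eq_mktuple do rewrite Dgamma.
  exact: free_diag_rows.
Qed.

End SymmetryDimension.

Theorem theorem1 (R : realType) (n : nat) (V : set ('I_n -> R[i]))
    (dimG dimV : nat) :
  projective_variety V ->
  complex_manifold_dim (symmetry_group (vanishing_ideal V)) dimG ->
  variety_dim V dimV ->
  (dimG < dimV)%N ->
  ~ toric_variety V.
Proof.
move=> _ Gdim [Vchain _] ltGV [r [a VE]]; rewrite VE in Gdim Vchain.
have dimV_le := chain_length_le_rank (K := R[i]) a _ Vchain.
have := leq_trans dimV_le (rank_le_symmetry_dim (K := R[i]) a _ Gdim).
by rewrite leqNgt ltGV.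
Qed.
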